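(* For every integer $n\ge 0$, there is a bijection between the set of isomorphism classes of split graphs on $n$ vertices and the set of isomorphism classes of bipartite posets on $n$ elements.
   Context: A finite graph is a split graph if its vertex set can be partitioned into a clique and a stable set. A bipartite poset is a finite poset of height at most one, i.e. there are no three elements $x\prec y\prec z$. Posets are considered up to isomorphism. *)

(* Defs.v *)
From HB Require Import structures.
From mathcomp Require Import all_boot all_fingroup.

Set Implicit Arguments.
Unset Strict Implicit.
Unset Printing Implicit Defensive.

Section Structures.
Variable T : finType.

(* Relations are stored as finite functions so that the graphs, and the posets,
   with vertex (ground) set T form a finType. *)

Definition simple_axiom (e : {ffun T -> {ffun T -> bool}}) : bool :=
  [forall x, ~~ e x x] && [forall x, forall y, e x y == e y x].

Record sgraph := SGraph {
  sgraph_ffun : {ffun T -> {ffun T -> bool}};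
  _ : simple_axiom sgraph_ffun
}.

HB.instance Definition _ := [isSub for sgraph_ffun].
HB.instance Definition _ := [Finite of sgraph by <:].

Definition adj (G : sgraph) : rel T := fun x y => sgraph_ffun G x y.

Definition order_axiom (r : {ffun T -> {ffun T -> bool}}) : bool :=
  [&& [forall x, r x x],
      [forall x, forall y, (r x y && r y x) ==> (x == y)] &
      [forall x, forall y, forall z, (r x y && r y z) ==> r x z]].

Record poset := Poset {
  poset_ffun : {ffun T -> {ffun T -> bool}};
  _ : order_axiom poset_ffun
}.

HB.instance Definition _ := [isSub for poset_ffun].
HB.instance Definition _ := [Finite of poset by <:].

Definition ple (P : poset) : rel T := fun x y => poset_ffun P x y.
Definition plt (P : poset) : rel T := fun x y => (x != y) && ple P x y.

Definition clique (G : sgraph) (K : {set T}) : bool :=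
  [forall x in K, forall y in K, (x != y) ==> adj G x y].
Definition stable (G : sgraph) (S : {set T}) : bool :=
  [forall x in S, forall y in S, ~~ adj G x y].

(* Either part of the partition may be empty. *)
Definition split_graph (G : sgraph) : bool :=
  [exists K : {set T}, clique G K && stable G (~: K)].

Definition bipartite_poset (P : poset) : bool :=
  ~~ [exists x, exists y, exists z, plt P x y && plt P y z].

Definition rel_iso (r1 r2 : rel T) : bool :=
  [exists s : {perm T}, forall x, forall y, r1 x y == r2 (s x) (s y)].

Definition graph_iso : rel sgraph := fun G H => rel_iso (adj G) (adj H).
Definition poset_iso : rel poset := fun P Q => rel_iso (ple P) (ple Q).

Lemma sgraphP (G : sgraph) : irreflexive (adj G) /\ symmetric (adj G).
Proof.
case: G => e ax; have /andP[/forallP ir /forallP sy] := ax; split=> [x|x y].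
  exact/negbTE/ir.
exact/eqP/(forallP (sy x)).
Qed.

Lemma posetP (P : poset) :
  [/\ reflexive (ple P), antisymmetric (ple P) & transitive (ple P)].
Proof.
case: P => r ax; have /and3P[/forallP rr /forallP ra /forallP rt] := ax; split=> //.
- by move=> x y; move/implyP: (forallP (ra x) y) => h /h/eqP.
move=> y x z rxy ryz.
by have /implyP := forallP (forallP (rt x) y) z; apply; apply/andP.
Qed.

Lemma rel_isoP (r1 r2 : rel T) :
  reflect (exists s : {perm T}, forall x y, r1 x y = r2 (s x) (s y))
          (rel_iso r1 r2).
Proof.
apply: (iffP existsP) => -[s h]; exists s.
  by move=> x y; apply/eqP; apply: (forallP (forallP h x)).
by apply/forallP=> x; apply/forallP=> y; apply/eqP.
Qed.

Lemma rel_iso_refl (r : rel T) : rel_iso r r.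
Proof. by apply/rel_isoP; exists 1%g => x y; rewrite !perm1. Qed.

Lemma rel_iso_sym (r1 r2 : rel T) : rel_iso r1 r2 -> rel_iso r2 r1.
Proof.
move=> /rel_isoP[s h]; apply/rel_isoP; exists s^-1%g => x y.
by rewrite h !permKV.
Qed.

Lemma rel_iso_trans (r1 r2 r3 : rel T) :
  rel_iso r1 r2 -> rel_iso r2 r3 -> rel_iso r1 r3.
Proof.
move=> /rel_isoP[s h] /rel_isoP[t k]; apply/rel_isoP; exists (s * t)%g => x y.
by rewrite h k !permM.
Qed.

Lemma graph_iso_equiv : equivalence_rel graph_iso.
Proof.
apply/equivalence_relP; split=> [G|G H GH K]; first exact: rel_iso_refl.
by apply/idP/idP; apply: rel_iso_trans => //; apply: rel_iso_sym.
Qed.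

Lemma poset_iso_equiv : equivalence_rel poset_iso.
Proof.
apply/equivalence_relP; split=> [G|G H GH K]; first exact: rel_iso_refl.
by apply/idP/idP; apply: rel_iso_trans => //; apply: rel_iso_sym.
Qed.

End Structures.

(* Every graph (poset) with n vertices is isomorphic to one on 'I_n, so the
   isomorphism classes are taken among the structures on 'I_n. *)

Definition split_classes (n : nat) : {set {set sgraph 'I_n}} :=
  equivalence_partition (@graph_iso 'I_n) [set G | split_graph G].

Definition bipartite_classes (n : nat) : {set {set poset 'I_n}} :=
  equivalence_partition (@poset_iso 'I_n) [set P | bipartite_poset P].

Definition split_class (n : nat) : Type :=
  {C : {set sgraph 'I_n} | C \in split_classes n}.

Definition bipartite_class (n : nat) : Type :=
  {C : {set poset 'I_n} | C \in bipartite_classes n}.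

(* Main.v *)
Require Import Defs.
From HB Require Import structures.
From mathcomp Require Import all_boot all_fingroup.

(** Call a split partition [(K, S)] reduced if every vertex of [K] has a
    neighbour in [S]; one with [K] of least cardinality is reduced.  If [(K, S)]
    and [(K', S')] are both reduced and [K <> K'], then [K \ K' = {x}] and
    [K' \ K = {y}] with [x], [y] adjacent twins, so the transposition of [x] and
    [y] is an automorphism exchanging the two partitions.  Hence split graphs up
    to isomorphism are the same as reduced pairs (graph, partition) up to
    isomorphism.  The latter are the bipartite posets: [K] is the set of
    non-minimal elements, and the edges between [S] and [K] are the strict
    comparabilities. *)

Set Implicit Arguments.
Unset Strict Implicit.
Unset Printing Implicit Defensive.

(** * Bijections between sets of equivalence classes *)

Section QuotientBijection.
Variables (T1 T2 : finType) (R1 : rel T1) (R2 : rel T2).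
Variables (D1 : {set T1}) (D2 : {set T2}) (f : T1 -> T2).
Hypothesis R2_equiv : equivalence_rel R2.
Hypothesis f_dom : {in D1, forall x, f x \in D2}.
Hypothesis f_rel : {in D1 &, forall x y, R1 x y = R2 (f x) (f y)}.
Hypothesis f_surj : {in D2, forall y, exists2 x, x \in D1 & R2 y (f x)}.

Let block_preimset y x : y \in D2 -> x \in D1 -> R2 y (f x) ->
  D1 :&: f @^-1: [set z in D2 | R2 y z] = [set z in D1 | R1 x z].
Proof.
move=> yD xD yx; apply/setP=> z; rewrite !inE.
have [zD /=|//] := boolP (z \in D1).
have [_ /(_ _ _ yx) ->] := iffLR (equivalence_relP _) R2_equiv.
by rewrite f_dom //= f_rel.
Qed.

Lemma preimset_equivalence_partition C : C \in equivalence_partition R2 D2 ->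
  D1 :&: f @^-1: C \in equivalence_partition R1 D1.
Proof.
case/imsetP=> y yD ->; have [x xD yx] := f_surj yD.
by rewrite (block_preimset yD xD yx); apply/imsetP; exists x.
Qed.

(** As [f] preserves and reflects the relations and is surjective up to [R2], pulling back along [f]
    turns [R2]-classes into [R1]-classes. Preimages need no choice of representatives, hence the
    direction of [g]. *)
Lemma equivalence_partition_bijection :
  exists g : {C | C \in equivalence_partition R2 D2} ->
             {C | C \in equivalence_partition R1 D1}, bijective g.
Proof.
have [refl2 trans2] := iffLR (equivalence_relP _) R2_equiv.
pose g (C : {C | C \in equivalence_partition R2 D2}) :
    {C | C \in equivalence_partition R1 D1} :=
  Sub (D1 :&: f @^-1: val C) (preimset_equivalence_partition (valP C)).
exists g.
have g_inj : injective g.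
  move=> [C hC] [C' hC'] [/= eqg]; apply: val_inj => /=.
  have /imsetP[y yD defC] := hC; have /imsetP[y' yD' defC'] := hC'.
  have [x xD yx] := f_surj yD.
  have : x \in D1 :&: f @^-1: C by rewrite defC !inE xD f_dom.
  rewrite eqg defC' !inE => /and3P[_ _ y'x].
  by rewrite defC; apply/setP=> z; rewrite !inE (trans2 _ _ yx) (trans2 _ _ y'x).
(* Boolean equality lets [xchoose] pick the preimages that define the inverse. *)
have g_surj C : exists B, g B == C.
  case: C => C hC; have /imsetP[x xD defC] := hC.
  have hB : [set z in D2 | R2 (f x) z] \in equivalence_partition R2 D2.
    by apply/imsetP; exists (f x) => //; apply: f_dom.
  exists (Sub [set z in D2 | R2 (f x) z] hB); rewrite -val_eqE /= defC.
  by rewrite (block_preimset (f_dom xD) xD) ?refl2.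
exists (fun C => xchoose (g_surj C)) => C; last exact/eqP/(xchooseP (g_surj C)).
exact/g_inj/eqP/(xchooseP (g_surj (g C))).
Qed.

End QuotientBijection.

(** * Reduced split partitions and their uniqueness *)

Section SplitPartition.
Variable T : finType.
Implicit Types (G : sgraph T) (P Q : poset T) (K : {set T}).

Definition reduced_split G K :=
  [/\ {in K &, forall x y, x != y -> adj G x y},
      {in ~: K &, forall x y, ~~ adj G x y} &
      {in K, forall x, exists2 y, y \notin K & adj G x y}].

Lemma split_partitionP G K :
  reflect ({in K &, forall x y, x != y -> adj G x y} /\
           {in ~: K &, forall x y, ~~ adj G x y})
          (clique G K && stable G (~: K)).
Proof.
apply: (iffP andP) => -[cK sK]; split.
- by move=> x y xK yK; apply/implyP/(forall_inP (forall_inP cK x xK)).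
- by move=> x y xK yK; apply: (forall_inP (forall_inP sK x xK)).
- apply/forall_inP=> x xK; apply/forall_inP=> y yK; apply/implyP; exact: cK.
by apply/forall_inP=> x xK; apply/forall_inP=> y yK; apply: sK.
Qed.

Lemma reduced_split_exists G : split_graph G -> exists K, reduced_split G K.
Proof.
have [irr sym] := sgraphP G.
case/existsP=> K0 hK0; pose p K := clique G K && stable G (~: K).
case: (arg_minnP (P := p) (fun K => #|K|) hK0) => K hK minK; exists K.
have [cK sK] := split_partitionP _ _ hK; split=> // x xK.
case: (pickP [pred y | y \notin K & adj G x y]) => [y /andP[yK xy]|no_nbr].
  by exists y.
(* Without a neighbour outside [K], [x] can move to the stable side, against minimality. *)
suff /minK : p (K :\ x) by rewrite (cardsD1 x) xK add1n ltnn.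
apply/split_partitionP; split=> [y z|y z].
  by rewrite !inE => /andP[_ yK] /andP[_ zK]; apply: cK.
rewrite !inE !negb_and !negbK => /orP[/eqP->|yK] /orP[/eqP->|zK].
- by rewrite irr.
- by have := no_nbr z; rewrite /= zK /= => ->.
- by have := no_nbr y; rewrite /= yK /= sym => ->.
by apply: sK; rewrite inE.
Qed.

(** A vertex of [K] outside [K'] would have a neighbour outside [K], hence outside [K'], although
    the complement of [K'] is stable. *)
Lemma reduced_split_subset G K K' :
  reduced_split G K -> reduced_split G K' -> K' \subset K -> K = K'.
Proof.
case=> _ _ nK [_ sK' _] sub; apply/eqP; rewrite eqEsubset sub andbT.
apply/subsetP=> x xK; have [y yK xy] := nK x xK.
apply: contraLR xy => xK'; apply: sK'; rewrite inE //.
by apply: contra yK; apply: (subsetP sub).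
Qed.

(** Two distinct vertices of [K] outside [K'] would be both adjacent and non-adjacent. *)
Lemma split_setD_eq G K K' x z :
  {in K &, forall u v, u != v -> adj G u v} ->
  {in ~: K' &, forall u v, ~~ adj G u v} ->
  x \in K -> x \notin K' -> z \in K -> z \notin K' -> z = x.
Proof.
move=> cK sK' xK xK' zK zK'; apply/eqP/idPn => zx.
by have := sK' z x; rewrite !inE zK' xK' cK // => /(_ isT isT).
Qed.

(** Both set differences are singletons, so the cliques agree away from [x] and [y]. There [x] sees
    all of [K], being in that clique, and nothing else, being in the stable complement of [K']. *)
Lemma reduced_split_swap G K K' x y :
  reduced_split G K -> reduced_split G K' ->
  x \in K -> x \notin K' -> y \in K' -> y \notin K ->
  forall z, z != x -> z != y -> (z \in K) = (z \in K') /\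
    (adj G x z = (z \in K)).
Proof.
move=> [cK sK nK] [cK' sK' nK'] xK xK' yK' yK z zx zy.
have eqz : (z \in K) = (z \in K').
  apply/idP/idP=> zK; apply: contraT => zK'.
    by rewrite (split_setD_eq cK sK' xK xK' zK zK') eqxx in zx.
  by rewrite (split_setD_eq cK' sK yK' yK zK zK') eqxx in zy.
split=> //; have [zK|zK] := boolP (z \in K); first by rewrite cK // eq_sym.
by apply/negbTE/sK'; rewrite inE // -eqz.
Qed.

Lemma reduced_split_unique G K K' : reduced_split G K -> reduced_split G K' ->
  exists t : {perm T}, (forall u v, adj G u v = adj G (t u) (t v)) /\
                       (forall u, (u \in K) = (t u \in K')).
Proof.
move=> rK rK'; have [irr sym] := sgraphP G.
have [/(reduced_split_subset rK' rK) ->|/subsetPn[x xK xK']] :=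
  boolP (K \subset K').
  by exists 1%g; split=> u; rewrite ?perm1 // => v; rewrite !perm1.
have [/(reduced_split_subset rK rK') eqK|/subsetPn[y yK' yK]] :=
  boolP (K' \subset K); first by rewrite eqK (negbTE xK') in xK.
(* The previous lemma, applied once more with the two partitions exchanged, describes the neighbours
   of [y]. *)
have twin z : z != x -> z != y -> adj G x z = adj G y z.
  move=> zx zy.
  have [eqz ->] := reduced_split_swap rK rK' xK xK' yK' yK zx zy.
  by have [_ ->] := reduced_split_swap rK' rK yK' yK xK xK' zy zx.
exists (tperm x y); split=> [u v|u].
  case: (tpermP x y u) => [->|->|/eqP ux /eqP uy];
    case: (tpermP x y v) => [->|->|/eqP vx /eqP vy] //;
    rewrite ?irr ?twin // ?[adj G u _]sym ?twin //.
case: tpermP => [->|->|/eqP ux /eqP uy]; first by rewrite xK yK'.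
  by rewrite (negbTE yK) (negbTE xK').
by have [] := reduced_split_swap rK rK' xK xK' yK' yK ux uy.
Qed.

(** * From bipartite posets to split graphs *)

Definition nonminimal P : {set T} := [set x | [exists z, plt P z x]].

(** The comparability graph of [P] with its non-minimal elements completed to a clique. *)
Definition split_ffun P : {ffun T -> {ffun T -> bool}} :=
  [ffun x => [ffun y => (x != y) &&
     [|| (x \in nonminimal P) && (y \in nonminimal P), ple P x y | ple P y x]]].

Lemma split_ffun_simple P : simple_axiom (split_ffun P).
Proof.
apply/andP; split; first by apply/forallP=> x; rewrite !ffunE eqxx.
apply/forallP=> x; apply/forallP=> y; rewrite !ffunE [y == x]eq_sym.
by rewrite [(x \in _) && _]andbC [ple P x y || _]orbC.
Qed.

Definition split_of_poset P : sgraph T := SGraph (split_ffun_simple P).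

Lemma adj_split_of_poset P x y : adj (split_of_poset P) x y =
  (x != y) &&
    [|| (x \in nonminimal P) && (y \in nonminimal P), ple P x y | ple P y x].
Proof. by rewrite /adj /= !ffunE. Qed.

Lemma plt_nonminimal P x y : plt P x y -> y \in nonminimal P.
Proof. by move=> xy; rewrite inE; apply/existsP; exists x. Qed.

Lemma bipartite_plt_minimal P x y :
  bipartite_poset P -> plt P x y -> x \notin nonminimal P.
Proof.
move=> bP xy; apply: contra bP; rewrite inE => /existsP[z zx].
by apply/existsP; exists z; apply/existsP; exists x; apply/existsP; exists y;
  rewrite zx.
Qed.

(** The graph and the set of non-minimal elements determine the order: an edge between a minimal and
    a non-minimal element is a comparability, and nothing lies strictly below a minimal element. *)
Lemma ple_split_of_poset P x y : bipartite_poset P -> ple P x y =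
  (x == y) || [&& x \notin nonminimal P, y \in nonminimal P &
                  adj (split_of_poset P) x y].
Proof.
move=> bP; have [refl anti trans] := posetP P.
have [->|xy /=] := eqVneq x y; first by rewrite refl.
apply/idP/and3P=> [lexy|[xK yK]].
  have ltxy : plt P x y by rewrite /plt xy.
  split; [exact: bipartite_plt_minimal ltxy|exact: plt_nonminimal ltxy|].
  by rewrite adj_split_of_poset xy lexy orbT.
rewrite adj_split_of_poset (negbTE xK) /= => /andP[_ /orP[//|leyx]].
by rewrite (@plt_nonminimal P y x) // /plt eq_sym xy in xK.
Qed.

Lemma nonminimal_reduced_split P :
  bipartite_poset P -> reduced_split (split_of_poset P) (nonminimal P).
Proof.
move=> bP; split=> [x y xK yK xy|x y|x xK].
- by rewrite adj_split_of_poset xy xK yK.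
- rewrite !in_setC => xK yK.
  rewrite adj_split_of_poset (negbTE xK) /=; apply/negP=> /andP[xy] /orP[] le.
    by rewrite (@plt_nonminimal P x y) // /plt xy in yK.
  by rewrite (@plt_nonminimal P y x) // /plt eq_sym xy in xK.
have := xK; rewrite {1}inE => /existsP[z zx]; exists z.
  exact: bipartite_plt_minimal zx.
by case/andP: zx => zx lezx; rewrite adj_split_of_poset eq_sym zx lezx !orbT.
Qed.

Lemma split_of_poset_split P :
  bipartite_poset P -> split_graph (split_of_poset P).
Proof.
move=> /nonminimal_reduced_split[cK sK _].
by apply/existsP; exists (nonminimal P); apply/split_partitionP.
Qed.

Lemma poset_iso_split P Q : poset_iso P Q ->
  graph_iso (split_of_poset P) (split_of_poset Q).
Proof.
case/rel_isoP=> s sPQ; apply/rel_isoP; exists s => x y.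
have sK u : (u \in nonminimal P) = (s u \in nonminimal Q).
  rewrite !inE; apply/existsP/existsP=> -[z /andP[zu le]].
    by exists (s z); rewrite /plt (inj_eq perm_inj) zu -sPQ.
  exists (s^-1%g z); rewrite /plt sPQ permKV le andbT.
  by apply: contra zu => /eqP<-; rewrite permKV.
by rewrite !adj_split_of_poset !sK !sPQ (inj_eq perm_inj).
Qed.

(** A graph isomorphism [s] may fail to respect non-minimality. The pullback [K'] of [nonminimal Q]
    is still a reduced clique side, so an automorphism [t] carries [nonminimal P] to it, and [t]
    followed by [s] respects the orders. *)
Lemma split_iso_poset P Q : bipartite_poset P -> bipartite_poset Q ->
  graph_iso (split_of_poset P) (split_of_poset Q) -> poset_iso P Q.
Proof.
move=> bP bQ /rel_isoP[s sPQ].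
have [cQ sQ nQ] := nonminimal_reduced_split bQ.
pose K' := s @^-1: nonminimal Q.
have inK' u : (u \in K') = (s u \in nonminimal Q) by rewrite in_set.
have rK' : reduced_split (split_of_poset P) K'.
  split=> [x y|x y|x].
  - by rewrite !inK' sPQ => xK yK xy; apply: cQ; rewrite ?(inj_eq perm_inj).
  - by rewrite !in_setC !inK' sPQ => xK yK; apply: sQ; rewrite in_setC.
  rewrite inK' => /nQ[y yK xy]; exists (s^-1%g y); last by rewrite sPQ permKV.
  by rewrite inK' permKV.
have [t [tG tK]] := reduced_split_unique (nonminimal_reduced_split bP) rK'.
apply/rel_isoP; exists (t * s)%g => x y.
by rewrite !ple_split_of_poset // !tK !inK' tG sPQ !permM !(inj_eq perm_inj).
Qed.

(** * From split graphs back to bipartite posets *)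

Definition reduced_order G K : {ffun T -> {ffun T -> bool}} :=
  [ffun x => [ffun y => (x == y) || [&& x \notin K, y \in K & adj G x y]]].

Lemma reduced_order_axiom G K : order_axiom (reduced_order G K).
Proof.
apply/and3P; split; apply/forallP=> x; first by rewrite !ffunE eqxx.
  apply/forallP=> y; rewrite !ffunE [y == x]eq_sym.
  by case: eqP => //= _; apply/implyP=> /andP[/and3P[/negbTE->]]; rewrite andbF.
apply/forallP=> y; apply/forallP=> z; rewrite !ffunE.
have [->|_] := eqVneq x y; first exact/implyP.
have [->|_] := eqVneq y z;
  first by rewrite andbT orFb; apply/implyP=> ->; rewrite orbT.
(* Two strict steps never compose: the middle element would be both in [K] and outside it. *)
by apply/implyP=> /andP[/and3P[_ yK _] /and3P[]]; rewrite yK.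
Qed.

Lemma split_of_poset_surj G : split_graph G ->
  exists2 P, bipartite_poset P & split_of_poset P = G.
Proof.
have [irr sym] := sgraphP G; case/reduced_split_exists=> K [cK sK nK].
pose P := Poset (reduced_order_axiom G K).
have leP x y : ple P x y = (x == y) || [&& x \notin K, y \in K & adj G x y].
  by rewrite /ple /= !ffunE.
have ltP x y : plt P x y = [&& x \notin K, y \in K & adj G x y].
  by rewrite /plt leP; case: eqVneq => [->|//]; rewrite irr !andbF.
(* Reducedness enters here: each vertex of [K] has a neighbour outside [K], which lies below it. *)
have KP : nonminimal P = K.
  apply/setP=> x; rewrite inE; apply/existsP/idP=> [[z]|xK].
    by rewrite ltP => /and3P[].
  by have [y yK xy] := nK x xK; exists y; rewrite ltP yK xK sym.
exists P.
  apply/negP=> /existsP[x /existsP[y /existsP[z]]]; rewrite !ltP.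
  by case/andP=> /and3P[_ yK _] /and3P[]; rewrite yK.
apply/val_inj/ffunP=> x; apply/ffunP=> y.
rewrite -[LHS]/(adj (split_of_poset P) x y) -[RHS]/(adj G x y).
rewrite adj_split_of_poset KP !leP [y == x]eq_sym.
have [->|xy /=] := eqVneq x y; first by rewrite irr.
have [xK|xK] := boolP (x \in K); have [yK|yK] := boolP (y \in K) => /=.
- by rewrite cK.
- by rewrite sym.
- by rewrite orbF.
by apply/esym/negbTE/sK; rewrite inE.
Qed.

End SplitPartition.

(** * Passage to isomorphism classes *)

Theorem theorem4p1 (n : nat) :
  exists f : split_class n -> bipartite_class n, bijective f.
Proof.
apply: (@equivalence_partition_bijection _ _ _ _ _ _ (@split_of_poset 'I_n)).
- exact: graph_iso_equiv.
- by move=> P; rewrite !inE; apply: split_of_poset_split.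
- move=> P Q; rewrite !inE => bP bQ; apply/idP/idP; first exact: poset_iso_split.
  exact: split_iso_poset.
move=> G; rewrite inE => /split_of_poset_surj[P bP <-].
by exists P; rewrite ?inE //; apply: rel_iso_refl.
Qed.
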